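(* Let $f$ be a morphism from a skew truss $(A,\diamond,\circ,\sigma_A)$ to a skew truss $(B,\diamond,\circ,\sigma_B)$. Then: (1) For all $m,n\in\mathbb{N}$, $a\in(\mathrm{pi} f)^m$ and $b\in(\mathrm{pi} f)^n$, one has $a\circ b\in(\mathrm{pi} f)^{m+n+1}$. (2) The pith $\mathrm{pi} f$ is a sub-semigroup of $(A,\circ)$. (3) For all $m\in\mathbb{N}$ and $a\in(\mathrm{pi} f)^m$, $\sigma_A(a)\in(\mathrm{pi} f)^{m+1}$. (4) If, for any $(m,n)\in\mathbb{N}^2$, $\sigma_B^m(1_\diamond) = \sigma_B^n(1_\diamond)$ implies $m=n$, then the chambers $(\mathrm{pi} f)^n$, $n\in\mathbb{N}$, define a partition of $\mathrm{pi} f$, and $(\mathrm{pi} f,\circ)$ is an $\mathbb{N}_+$-graded semigroup with grading given by the chamber labels shifted by one, i.e. with $\deg(a) = n+1$ if and only if $a\in(\mathrm{pi} f)^n$.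
   Context: A skew (left) truss is a quadruple $(A,\diamond,\circ,\sigma)$ where $(A,\diamond)$ is a group (neutral element $1_\diamond$, inverses $a^\diamond$), $(A,\circ)$ is a semigroup and $\sigma:A\to A$ is a function such that for all $a,b,c\in A$, $a\circ(b\diamond c) = (a\circ b)\diamond\sigma(a)^\diamond\diamond(a\circ c)$. A morphism of skew trusses is a function that is a homomorphism of the corresponding groups (for $\diamond$) and of the corresponding semigroups (for $\circ$). Here $\mathbb{N} = \{0,1,2,\dots\}$, $\mathbb{N}_+ = \{1,2,\dots\}$, and $\sigma_B^n$ is the $n$-fold composition of $\sigma_B$ with itself ($\sigma_B^0=\mathrm{id}$). For a morphism $f:A\to B$ of skew trusses and $n\in\mathbb{N}$, the $n$-th chamber of the pith of $f$ is $(\mathrm{pi} f)^n := \{a\in A\mid f(a) = \sigma_B^n(1_\diamond)\}$, where $1_\diamond$ is the neutral element of $(B,\diamond)$, and the pith of $f$ is $\mathrm{pi} f := \bigcup_{n\in\mathbb{N}}(\mathrm{pi} f)^n$. A semigroup $(P,\circ)$ is $\mathbb{N}_+$-graded if it is equipped with a function $\deg:P\to\mathbb{N}_+$ with $\deg(a\circ b) = \deg(a)+\deg(b)$ for all $a,b\in P$. *)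

(* Defs.v *)
From HB Require Import structures.
From mathcomp Require Import all_boot.
From mathcomp Require Import boolp classical_sets.

Set Implicit Arguments.
Unset Strict Implicit.
Unset Printing Implicit Defensive.

Local Open Scope classical_set_scope.
Local Open Scope group_scope.

Reserved Notation "a \circ b" (at level 40, left associativity).
Reserved Notation "A ^circ" (at level 2, format "A ^circ").
Reserved Notation "'{' 'trussmorphism' A '->' B '}'"
  (at level 0, A at level 98, B at level 99,
   format "{ 'trussmorphism'  A  ->  B }").

(* The group law (A, diamond), in general not commutative, is the
   multiplicative law of groupType: a * b, 1, a^-1. *)
HB.mixin Record Group_isSkewTruss A of Group A := {
  circ : A -> A -> A;
  sigma : A -> A;
  circA : associative circ;
  circ_distr : forall a b c : A,
    circ a (b * c) = circ a b * (sigma a)^-1 * circ a c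
}.

#[short(type="skewTrussType")]
HB.structure Definition SkewTruss := {A of Group_isSkewTruss A & Group A}.

Notation "a \circ b" := (circ a b) : group_scope.

HB.mixin Record isCircMorphism (A B : skewTrussType) (f : A -> B) := {
  tmorphC : {morph f : a b / a \circ b}
}.

HB.structure Definition SkewTrussMorphism (A B : skewTrussType) :=
  {f of isMultiplicative A B f & isCircMorphism A B f}.

Notation "{ 'trussmorphism' A -> B }" :=
  (SkewTrussMorphism.type A B) : type_scope.

(* A^circ is an alias of A on which the canonical multiplication is \circ. *)
Definition circ_semigroup (A : skewTrussType) : Type := A.
Notation "A ^circ" := (circ_semigroup A) : type_scope.

HB.instance Definition _ (A : skewTrussType) := Choice.on A^circ.
HB.instance Definition _ (A : skewTrussType) := isSemigroup.Build A^circ circA.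

Section SubSemigroup.
Variables (G : semigroupType) (P : set G).

Definition subsemigroup : Prop := mulg_closed [pred x | x \in P].

(* The elements of P, with the restriction of the law of G; the proof of
   closure is an argument so that the law can be inferred from the type. *)
Definition subsemigroup_type of subsemigroup : Type := P.

Variable clP : subsemigroup.
HB.instance Definition _ := SubChoice.on (subsemigroup_type clP).
HB.instance Definition _ :=
  SubChoice_isSubSemigroup.Build G (fun x => x \in P) (subsemigroup_type clP)
    clP.
End SubSemigroup.

(* N_+-gradings; the codomain N_+ is rendered as the positive elements of nat. *)
Definition posnat_grading (P : semigroupType) (deg : P -> nat) : Prop :=
  (forall a : P, 0 < deg a) /\
  (forall a b : P, deg (a * b) = (deg a + deg b)%N).

Section Pith.
Variables (A B : skewTrussType) (f : {trussmorphism A -> B}).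

Definition chamber (n : nat) : set A := [set a | f a = iter n sigma 1].

Definition pith : set A := \bigcup_n chamber n.
End Pith.

(* Main.v *)
(** Distributivity at [b = c = 1] gives [sigma a = a \circ 1]: so [f] commutes
    with [sigma], and [iter n sigma 1] is the [\circ]-product of [n.+1] copies of
    [1]. *)

Require Import Defs.
From mathcomp Require Import all_boot.
From mathcomp Require Import boolp classical_sets.

Set Implicit Arguments.
Unset Strict Implicit.
Unset Printing Implicit Defensive.

Local Open Scope classical_set_scope.
Local Open Scope group_scope.

(** Since [sigma] is right [\circ]-multiplication by [1], associativity turns right multiplication
    by [iter n sigma 1] into [n.+1] applications of [sigma] ([circ_iter_sigma1]). Hence in [B] the
    elements labelled [m] and [n] multiply to the one labelled [m + n + 1], and pulling back along
    [f] gives (1)-(3). If the orbit of [1] in [B] has no repetition, labels are unique, and the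
    shift by one makes them additive. *)

Lemma sigmaE (A : skewTrussType) (a : A) : sigma a = a \circ 1.
Proof.
have := circ_distr a 1 1; rewrite mulg1 -mulgA -[LHS]mulg1.
by move=> /mulgI /esym /(canRL (mulKg _)); rewrite invgK mulg1 => ->.
Qed.

Lemma circ_iter_sigma1 (A : skewTrussType) (n : nat) (a : A) :
  a \circ iter n sigma 1 = iter n.+1 sigma a.
Proof.
elim: n => [|n IHn]; first by rewrite /= sigmaE.
by rewrite iterS sigmaE circA IHn -sigmaE.
Qed.

Section PithTheory.
Variables (A B : skewTrussType) (f : {trussmorphism A -> B}).

(** Morphisms carry only multiplicativity, so this comes from cancelling [f 1] in
    [f 1 * f 1 = f 1 * 1]. *)
Lemma trussmorph1 : f 1 = 1.
Proof. by apply: (@mulgI _ (f 1)); rewrite -gmulfM !mulg1. Qed.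

Lemma trussmorph_sigma (a : A) : f (sigma a) = sigma (f a).
Proof. by rewrite !sigmaE tmorphC trussmorph1. Qed.

Lemma chamber_circ (m n : nat) (a b : A) :
  chamber f m a -> chamber f n b -> chamber f (m + n + 1) (a \circ b).
Proof.
rewrite /chamber /= => fa fb.
by rewrite tmorphC fa fb circ_iter_sigma1 -iterD addSn addnC addn1.
Qed.

Lemma chamber_sigma (m : nat) (a : A) :
  chamber f m a -> chamber f (m + 1) (sigma a).
Proof. by rewrite /chamber /= addn1 trussmorph_sigma => ->. Qed.

(** Needed because [partition] asks for nonempty blocks; the induction produces [iter n sigma 1],
    computed in [A], as a witness. *)
Lemma chamber_nonempty (n : nat) : chamber f n !=set0.
Proof.
elim: n => [|n [a fa]]; first by exists 1; exact: trussmorph1.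
by exists (sigma a); rewrite -addn1; exact: chamber_sigma.
Qed.

Lemma pith_subsemigroup : @subsemigroup A^circ (pith f).
Proof.
move=> a b; rewrite !inE => -[m _ fa] [n _ fb].
by exists (m + n + 1)%N => //; exact: chamber_circ.
Qed.

Hypothesis iter_sigma1_inj : forall m n : nat,
  iter m sigma (1 : B) = iter n sigma (1 : B) -> m = n.

Lemma chamber_inj (m n : nat) (a : A) :
  chamber f m a -> chamber f n a -> m = n.
Proof. by rewrite /chamber /= => -> /iter_sigma1_inj. Qed.

Lemma chamber_partition : partition [set: nat] (chamber f) (pith f).
Proof.
split=> //; last by move=> n _; exact: chamber_nonempty.
by move=> m n _ _ [a [fm fn]]; exact: chamber_inj fm fn.
Qed.

Lemma pith_grading (clP : @subsemigroup A^circ (pith f)) :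
  exists deg : subsemigroup_type clP -> nat,
    posnat_grading deg /\
    (forall (a : subsemigroup_type clP) (n : nat),
       deg a = n.+1 <-> chamber f n (val a)).
Proof.
(* Choice picks a label for each element of the pith; by [chamber_inj] it is the only one. *)
have /choice[lbl lblP] (a : subsemigroup_type clP) :
    exists n, chamber f n (val a).
  by have := valP a; rewrite inE => -[n _]; exists n.
exists (fun a => (lbl a).+1); split; last first.
  move=> a n; split=> [[<-]|fa]; first exact: lblP.
  by rewrite (chamber_inj (lblP a) fa).
(* Removing one successor from each side leaves [m + n + 1], the chamber of the product. *)
split=> // a b; rewrite addSn addnS -[(_ + _).+1]addn1; congr _.+1.
exact: chamber_inj (lblP (a * b)) (chamber_circ (lblP a) (lblP b)).
Qed.

End PithTheory.

Theorem lemma3p3 (A B : skewTrussType) (f : {trussmorphism A -> B}) :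
  [/\ (forall (m n : nat) (a b : A),
         chamber f m a -> chamber f n b -> chamber f (m + n + 1) (a \circ b)),
      @subsemigroup A^circ (pith f),
      (forall (m : nat) (a : A),
         chamber f m a -> chamber f (m + 1) (sigma a)) &
      (forall m n : nat,
         iter m sigma (1 : B) = iter n sigma (1 : B) -> m = n) ->
      partition [set: nat] (chamber f) (pith f) /\
      exists (clP : @subsemigroup A^circ (pith f))
             (deg : subsemigroup_type clP -> nat),
        posnat_grading deg /\
        (forall (a : subsemigroup_type clP) (n : nat),
           deg a = n.+1 <-> chamber f n (val a))].
Proof.
split.
- exact: chamber_circ.
- exact: pith_subsemigroup.
- exact: chamber_sigma.
move=> inj; split; first exact: chamber_partition.
by exists (@pith_subsemigroup A B f); exact: pith_grading.
Qed.
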